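(* A subshift $X\subset\Sigma^{\mathbb Z}$ ($\Sigma$ a finite alphabet) admits a presentation that has property $g$ (i.e. is topologically conjugate to a subshift that has property $g$) if and only if $X$ has property $RI$.
   Context: A subshift $X\subset\Sigma^{\mathbb Z}$ over a finite alphabet $\Sigma$ is a closed shift-invariant set. Two subshifts are topologically conjugate if there is a shift-commuting homeomorphism between them. For an interval $I$ of integers, $X_I=\{(x_j)_{j\in I}:x\in X\}$; for a block $b$ indexed by an interval containing $I$, $b_I=(b_j)_{j\in I}$. Blocks also stand for the words they carry, i.e. they may be translated: $X_{[i,k]}$ and $X_{[i+m,k+m]}$ are identified. Property $g$. For a word $a\in X_{(-k,0]}$, $\omega_1^+(a)$ is the set of $\sigma\in\Sigma$ such that $(y^-,a,\sigma)\in X_{(-\infty,1]}$ for all $y^-\in X_{(-\infty,-k]}$ with $(y^-,a)\in X_{(-\infty,0]}$. For $x^-\in X_{(-\infty,0]}$, $\Delta_1^+(x^-)=\bigcup_{n\in\mathbb N}\omega_1^+(x^-_{[-n,0]})$. A subshift $X$ has property $g$ if $\Delta_1^+(x^-)\neq\emptyset$ for all $x^-\in X_{(-\infty,0]}$. Property $RI$. Let $L\in\mathbb Z_+$ and let $\Psi:X_{[-L,L]}\to X_{[1,L+1]}$ be a mapping. Condition (RIa): for all $a\in X_{[-L,L]}$ and all $x^-\in X_{(-\infty,-L)}$ with $(x^-,a)\in X_{(-\infty,L]}$, one has $(x^-,a_{[-L,0]},\Psi(a))\in X_{(-\infty,L+1]}$. If $\Psi$ satisfies (RIa), then for $0\le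 n<L$ and $b\in X_{[-L-n,L]}$ the word $$a_{n,b}=(b_{[-L-n,0]},\Psi(b_{[-L,L]})_{(0,L-n]})$$ is in $X_{[-L-n,L-n]}$. Condition (RIb): $\Psi(a_{n,b})=\Psi(b_{[-L-n,L-n]})$ for all $b\in X_{[-L-n,L]}$ and $0\le n<L$ (here $\Psi$ is applied to blocks in $X_{[-L-n,L-n]}$ after translation to $X_{[-L,L]}$). A mapping $\Psi$ satisfying (RIa) and (RIb) is an $RI$-mapping, and $X$ has property $RI$ if it has an $RI$-mapping for some $L\in\mathbb Z_+$. *)

(* Defs.v *)
From mathcomp Require Import all_boot all_order all_algebra.
From mathcomp Require Import all_classical.
From mathcomp Require Import topology.

Set Implicit Arguments.
Unset Strict Implicit.
Unset Printing Implicit Defensive.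

Import GRing.Theory.

Local Open Scope classical_set_scope.
Local Open Scope ring_scope.

(* The full shift S^Z with the product of the discrete topologies. *)
Definition full_shift (S : finType) : topologicalType :=
  prod_topology (fun _ : int => discrete_topology S).

Definition shift (S : finType) (x : full_shift S) : full_shift S :=
  fun i => x (i + 1).

Definition subshift (S : finType) (X : set (full_shift S)) : Prop :=
  closed X /\ [set shift x | x in X] = X.

(* Here a set X used as a type is the type of its elements, with the topology
   induced by [full_shift]. Elements x and y of X with [val y = shift (val x)]
   are compared instead of using the restriction of [shift] to X. *)
Definition conjugate (S T : finType)
    (X : set (full_shift S)) (Y : set (full_shift T)) : Prop :=
  exists (f : X -> Y) (g : Y -> X),
    [/\ continuous f, continuous g, cancel f g, cancel g f &
        forall x y : X, val y = shift (val x) -> val (f y) = shift (val (f x))].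

(* The block x_[i, i + n), as the word that it carries. *)
Definition block (S : finType) (x : full_shift S) (i : int) (n : nat) : seq S :=
  mkseq (fun j => x (i + j%:Z)) n.

(* X_[i, i + n). Since words carry no position, X_[i, k] and X_[i + m, k + m]
   are identified, as sets of words, for a shift-invariant X. *)
Definition blocks (S : finType) (X : set (full_shift S)) (i : int) (n : nat) :
    set (seq S) :=
  [set block x i n | x in X].

(* A left-infinite sequence (.., r 2, r 1, r 0) is indexed from its right end:
   x_(-oo, m] is the sequence r with r j = x (m - j). *)
Definition left_ray (S : finType) (x : full_shift S) (m : int) : nat -> S :=
  fun j => x (m - j%:Z).

(* X_(-oo, m] *)
Definition left_rays (S : finType) (X : set (full_shift S)) (m : int) :
    set (nat -> S) :=
  [set left_ray x m | x in X].

Definition ray_rcons (S : Type) (r : nat -> S) (s : S) : nat -> S :=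
  fun j => if j is j'.+1 then r j' else s.

(* The left-infinite sequence (r, w), with w on the right of r. *)
Definition ray_cat (S : Type) (r : nat -> S) (w : seq S) : nat -> S :=
  foldl (@ray_rcons S) r w.

(* The last n entries of r, read from left to right. *)
Definition ray_suffix (S : Type) (r : nat -> S) (n : nat) : seq S :=
  rev (mkseq r n).

(* omega_1^+(a) for a in X_(-k, 0], where k = size a. *)
Definition omega1 (S : finType) (X : set (full_shift S)) (a : seq S) : set S :=
  [set s | forall y : nat -> S,
     left_rays X (- (size a)%:Z) y -> left_rays X 0 (ray_cat y a) ->
     left_rays X 1 (ray_cat y (rcons a s))].

(* Delta_1^+(r) for r in X_(-oo, 0]. *)
Definition Delta1 (S : finType) (X : set (full_shift S)) (r : nat -> S) :
    set S :=
  \bigcup_(n : nat) omega1 X (ray_suffix r n.+1).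

Definition property_g (S : finType) (X : set (full_shift S)) : Prop :=
  forall r, left_rays X 0 r -> Delta1 X r !=set0.

(* Psi is only constrained on X_[-L, L] (words of length 2L + 1), which it maps
   into X_[1, L + 1] (words of length L + 1). *)
Definition RI_domain (S : finType) (X : set (full_shift S)) (L : nat)
    (Psi : seq S -> seq S) : Prop :=
  forall a, blocks X (- L%:Z) (2 * L).+1 a -> blocks X 1 L.+1 (Psi a).

(* In [RIa], a is indexed by [-L, L], so that [take L.+1 a] is a_[-L, 0]. *)
Definition RIa (S : finType) (X : set (full_shift S)) (L : nat)
    (Psi : seq S -> seq S) : Prop :=
  forall (a : seq S) (r : nat -> S),
    blocks X (- L%:Z) (2 * L).+1 a ->
    left_rays X (- L%:Z - 1) r ->
    left_rays X L%:Z (ray_cat r a) ->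
    left_rays X L.+1%:Z (ray_cat r (take L.+1 a ++ Psi a)).

(* The word a_{n, b}. Here b is indexed by [-L - n, L]: b_[-L - n, 0] is
   [take (L + n).+1 b] and b_[-L, L] is [drop n b]. *)
Definition RI_word (S : finType) (L : nat) (Psi : seq S -> seq S) (n : nat)
    (b : seq S) : seq S :=
  take (L + n).+1 b ++ take (L - n) (Psi (drop n b)).

(* b_[-L - n, L - n] is [take (2 * L).+1 b]. *)
Definition RIb (S : finType) (X : set (full_shift S)) (L : nat)
    (Psi : seq S -> seq S) : Prop :=
  forall (n : nat) (b : seq S), (n < L)%N ->
    blocks X (- (L + n)%:Z) (2 * L + n).+1 b ->
    Psi (RI_word L Psi n b) = Psi (take (2 * L).+1 b).

Definition RI_mapping (S : finType) (X : set (full_shift S)) (L : nat)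
    (Psi : seq S -> seq S) : Prop :=
  [/\ RI_domain X L Psi, RIa X L Psi & RIb X L Psi].

Definition property_RI (S : finType) (X : set (full_shift S)) : Prop :=
  exists (L : nat) (Psi : seq S -> seq S), RI_mapping X L Psi.

(* Main.v *)
(* An RI-mapping Psi yields the presentation Y of X by the points
   y_i = (x_i, Psi(x_[i - L, i + L])). Replacing x_(0, oo) by a continuation
   that starts with Psi(x_[-L, L]) keeps y_(-oo, 0] by (RIb), and then y_1 is
   determined by y_[-L, 0], so that it can follow every past that ends with
   this block.

   Conversely, let X be conjugate to Y with property g. By compactness there is
   an N such that every block of N + 1 symbols of Y has a symbol in its omega_1^+,
   and the codes f : X -> Y, g : Y -> X have a common window [-M, M]. With
   L = N + 2M, x_[-L, L] determines y = f x on the N + 2M + 1 coordinates up to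
   M. One keeps y_(-oo, M], continues it canonically on (M, M + L + 1], and
   decodes x' = g y' on [1, L + 1]. For (RIb): x and x' have the same image under
   f up to M, and hence the same canonical continuations at all coordinates
   -n <= 0. *)
Require Import Defs.
From mathcomp Require Import all_boot all_order all_algebra.
From mathcomp Require Import all_classical topology.
From mathcomp Require Import zify.

Set Implicit Arguments.
Unset Strict Implicit.
Unset Printing Implicit Defensive.

Import GRing.Theory.

Local Open Scope classical_set_scope.
Local Open Scope ring_scope.

(** * Cylinder topology and compactness of the full shift *)

Section Topology.
Variable S : finType.
Implicit Types (X : set (full_shift S)) (x y : full_shift S).

Definition cylinder (n : nat) x : set (full_shift S) :=
  [set y | forall j : int, (`|j| <= n)%N -> y j = x j].

Lemma nbhs_coord x (j : int) : nbhs x [set y : full_shift S | y j = x j].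
Proof.
have /(_ x [set x j]) := @proj_continuous _ (fun _ : int => discrete_topology S) j.
by apply; exact: discrete_set1.
Qed.

Lemma nbhs_cylinderP x (A : set (full_shift S)) :
  nbhs x A <-> exists n, cylinder n x `<=` A.
Proof.
split=> [|[n]].
  pose F : set_system (full_shift S) :=
    filter_from [set: nat] (fun n => cylinder n x).
  have FF : Filter F.
    apply: filter_from_filter; first by exists 0%N.
    move=> m n _ _; exists (maxn m n) => // y cy.
    by split=> j lej; apply: cy; rewrite leq_max lej ?orbT.
  suff : F --> x by move=> cvF /cvF [n _ cA]; exists n.
  (* Convergence in the product is tested one coordinate at a time, and the cylinder of radius [|j|]
     fixes coordinate [j]. *)
  apply/cvg_sup => j U [_ [[B _ <-] Bxj BU]].
  by exists `|j|%N => // y cy; apply: BU => /=; rewrite cy.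
have FF : Filter (nbhs x) := nbhs_filter x.
move=> /filterS; apply.
elim: n => [|n IHn].
  by apply: (@filterS _ (nbhs x) FF _ _ _ (nbhs_coord x 0)) => y y0 j; rewrite leqn0 absz_eq0 => /eqP ->.
have [Hp Hn] := (nbhs_coord x n.+1%:Z, nbhs_coord x (- n.+1%:Z)).
have H := @filterI _ _ FF _ _ IHn (@filterI _ _ FF _ _ Hp Hn).
apply: (@filterS _ (nbhs x) FF _ _ _ H) => y [cy [yp yn]] j lej.
have [/cy //|] := leqP `|j|%N n => ltj.
have [->//|->//] : j = n.+1%:Z \/ j = - n.+1%:Z by lia.
Qed.

Lemma full_shift_compact : compact [set: full_shift S].
Proof.
have -> : [set: full_shift S] =
    [set x : forall _ : int, discrete_topology S | forall i, [set: discrete_topology S] (x i)].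
  by apply/seteqP; split.
apply: (@tychonoff _ (fun=> discrete_topology S) (fun=> setT)) => _.
by apply: finite_compact; exact: (@finite_finset S).
Qed.

Lemma full_shift_hausdorff : hausdorff_space (full_shift S).
Proof.
by apply: hausdorff_product => j; exact: discrete_hausdorff.
Qed.

Lemma subshift_compact X : subshift X -> compact X.
Proof.
by case=> clX _; exact: subclosed_compact clX full_shift_compact (@subsetT _ X).
Qed.

(** Near-covering form of compactness: bounds valid on cylinders around each point merge into one by
    monotonicity. It yields both the radius of a block code and the memory in property g. *)
Lemma compact_uniform X (P : nat -> set (full_shift S)) : compact X ->
  (forall m n x, (m <= n)%N -> X x -> P m x -> P n x) ->
  (forall x, X x -> exists m, forall y, X y -> cylinder m x y -> P m y) ->
  exists n, forall x, X x -> P n x.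
Proof.
move=> /compact_near_coveringP/near_covering_withinP cptX monoP locP.
have [|n _ /(_ n (leqnn n)) Pn] := cptX nat \oo P _; last by exists n.
move=> x Xx; have [m Pm] := locP x Xx.
exists (cylinder m x, [set n | (m <= n)%N]) => /=.
  by split; [apply/nbhs_cylinderP; exists m|exists m].
by move=> [y n] /= [cy lemn] Xy; exact: monoP lemn Xy (Pm y Xy cy).
Qed.

End Topology.

Lemma continuous_cylinder (S T : finType) (X : set (full_shift S))
    (Y : set (full_shift T)) (f : X -> Y) (n : nat) (u : X) : continuous f ->
  exists m, forall v : X, cylinder m (val u) (val v) ->
    cylinder n (val (f u)) (val (f v)).
Proof.
move=> cf.
have nU : nbhs (f u) (val @^-1` cylinder n (val (f u))).
  apply: (@initial_continuous Y (full_shift T) set_val).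
  by apply/nbhs_cylinderP; exists n.
have [_ [[B oB <-] Bu BU]] := cf u _ nU.
have /nbhs_cylinderP [m cB] : nbhs (val u) B by apply: open_nbhs_nbhs.
by exists m => v /cB /BU.
Qed.

Lemma local_continuous (S T : finType) (X : set (full_shift S))
    (Y : set (full_shift T)) (f : X -> Y) (m : nat) :
  (forall (u v : X) (k : int),
    (forall j : int, (`|j| <= m)%N -> val v (k + j) = val u (k + j)) ->
    val (f v) k = val (f u) k) ->
  continuous f.
Proof.
move=> locf u U [_ [[B oB <-] Bu BU]].
have /nbhs_cylinderP [n cB] : nbhs (val (f u)) B by apply: open_nbhs_nbhs.
have nU : nbhs u (val @^-1` cylinder (n + m) (val u)).
  apply: (@initial_continuous X (full_shift S) set_val).
  by apply/nbhs_cylinderP; exists (n + m)%N.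
apply: (@filterS _ (nbhs u) (nbhs_filter u) _ _ _ nU) => v cv; apply/BU/cB => k lek; apply: locf => j lej.
by apply: cv; lia.
Qed.

(** * Translates, words and left-infinite sequences *)

Section Words.
Variable S : finType.
Implicit Types (X : set (full_shift S)) (x y : full_shift S) (w : seq S).

Definition translate (k : int) x : full_shift S := fun i => x (i + k).

Lemma subshift_translate X x (k : int) : subshift X -> X x -> X (translate k x).
Proof.
move=> [_ shX] Xx.
have trN n : X (translate n%:Z x).
  elim: n => [|n IHn].
    by rewrite (_ : translate _ _ = x)//; apply/funext => i; congr (x _); lia.
  rewrite -shX; exists (translate n%:Z x) => //.
  by apply/funext => i; rewrite /shift /translate; congr (x _); lia.
(* Backward translates stay in [X] because the shift maps [X] onto itself: each step takes a
   preimage under the shift. *)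
have trNn n : X (translate (- n%:Z) x).
  elim: n => [|n]; first exact: (trN 0%N).
  rewrite -{1}shX => -[y Xy yE].
  rewrite (_ : translate _ _ = y)//; apply/funext => i.
  have /(congr1 (fun z => z (i - 1))) := yE.
  rewrite /shift /translate subrK => ->; congr (x _); lia.
have [n [->|->]] : exists n : nat, k = n%:Z \/ k = - n%:Z by exists `|k|%N; lia.
  exact: trN.
exact: trNn.
Qed.

Lemma size_block x i n : size (block x i n) = n.
Proof. exact: size_mkseq. Qed.

Lemma eq_block x y i k n :
  block x i n = block y k n <->
  (forall j : nat, (j < n)%N -> x (i + j%:Z) = y (k + j%:Z)).
Proof.
split=> [xy j ltj|xy].
  by have /(congr1 (fun w => nth (x i) w j)) := xy; rewrite !nth_mkseq.
by apply/eq_in_map => j; rewrite mem_iota => /xy.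
Qed.

Lemma block_cat x i m n :
  block x i (m + n) = block x i m ++ block x (i + m%:Z) n.
Proof.
rewrite /block /mkseq iotaD map_cat add0n; congr (_ ++ _).
rewrite -{1}[m]addn0 iotaDl -map_comp; apply: eq_map => j /=.
by congr (x _); lia.
Qed.

Lemma take_block x i m n : (m <= n)%N -> take m (block x i n) = block x i m.
Proof. by move=> /subnKC <-; rewrite block_cat take_size_cat// size_block. Qed.

Lemma drop_block x i m n : (m <= n)%N ->
  drop m (block x i n) = block x (i + m%:Z) (n - m).
Proof.
by move=> /subnKC {1}<-; rewrite block_cat drop_size_cat// size_block.
Qed.

Lemma block_rcons x i n :
  block x i n.+1 = rcons (block x i n) (x (i + n%:Z)).
Proof. exact: mkseqS. Qed.

Lemma eq_left_ray x y m k :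
  left_ray x m = left_ray y k <-> (forall j : int, j <= 0 -> x (m + j) = y (k + j)).
Proof.
split=> [xy j j0|xy]; last by apply/funext => j; apply: xy; lia.
have /(congr1 (fun r => r `|j|%N)) := xy; rewrite /left_ray.
by have -> : - (`|j|%N)%:Z = j by lia.
Qed.

Lemma ray_rcons_left_ray r (s : S) x m :
  ray_rcons r s = left_ray x m <-> r = left_ray x (m - 1) /\ s = x m.
Proof.
split=> [rs|[-> ->]].
  split; last by have /(congr1 (fun r => r 0%N)) /= -> := rs; rewrite /left_ray subr0.
  apply/funext => j; have /(congr1 (fun r => r j.+1)) /= -> := rs.
  by congr (x _); lia.
by apply/funext => -[|j] /=; congr (x _); lia.
Qed.

Lemma ray_cat_rcons (r : nat -> S) w s :
  ray_cat r (rcons w s) = ray_rcons (ray_cat r w) s.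
Proof. exact: foldl_rcons. Qed.

Lemma ray_cat_left_ray r w x m :
  ray_cat r w = left_ray x m <->
  r = left_ray x (m - (size w)%:Z) /\
  w = block x (m - (size w)%:Z + 1) (size w).
Proof.
elim/last_ind: w m => [|w s IHw] m.
  by rewrite /ray_cat /= subr0; split=> [|[]].
rewrite ray_cat_rcons ray_rcons_left_ray IHw size_rcons.
rewrite block_rcons.
have -> : m - (size w).+1%:Z = m - 1 - (size w)%:Z by lia.
have -> : m - 1 - (size w)%:Z + 1 + (size w)%:Z = m by lia.
by split=> [[[-> <-] <-]|[-> /rcons_inj [<- <-]]].
Qed.

Lemma ray_suffix_left_ray x m n :
  ray_suffix (left_ray x m) n = block x (m - n%:Z + 1) n.
Proof.
apply: (@eq_from_nth _ (x 0)); rewrite size_rev size_mkseq ?size_block// => j ltj.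
rewrite nth_rev ?size_mkseq// !nth_mkseq//; last by lia.
by rewrite /left_ray; congr (x _); lia.
Qed.

Lemma left_rays_subshift X m r : subshift X ->
  left_rays X m r <-> left_rays X 0 r.
Proof.
move=> sX; split=> -[x Xx <-].
  exists (translate m x); first exact: subshift_translate.
  by apply/funext => j; rewrite /left_ray /translate; congr (x _); lia.
exists (translate (- m) x); first exact: subshift_translate.
by apply/funext => j; rewrite /left_ray /translate; congr (x _); lia.
Qed.

(** Shift invariance lets the context sit at any position of any point, so that pasts become points
    of [X] and concatenation of rays becomes agreement up to [m]. *)
Lemma omega1P X w s : subshift X ->
  omega1 X w s <->
  (forall x m, X x -> block x (m - (size w)%:Z + 1) (size w) = w ->
    exists y, [/\ X y, forall j : int, j <= m -> y j = x j & y (m + 1) = s]).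
Proof.
move=> sX; split=> [ws x m Xx xw|ws r _ [x Xx]].
  pose z := translate m x.
  have Xz : X z by exact: subshift_translate.
  have zw : ray_cat (left_ray z (- (size w)%:Z)) w = left_ray z 0.
    apply/ray_cat_left_ray; rewrite sub0r; split=> //; rewrite -{1}xw.
    by apply/eq_block => j _; rewrite /z /translate; congr (x _); lia.
  have [||y Xy] := ws (left_ray z (- (size w)%:Z)).
  - by exists z.
  - by exists z.
  rewrite ray_cat_rcons zw.
  move=> /esym/ray_rcons_left_ray[yz ys].
  exists (translate (- m) y); split; first exact: subshift_translate.
    move=> j lej; have /eq_left_ray/(_ (j - m)) yzj := esym yz.
    transitivity (y (1 - 1 + (j - m))); first by congr (y _); lia.
    by rewrite yzj; [congr (x _)|]; lia.
  by rewrite ys /translate; congr (y _); lia.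
move=> /esym/ray_cat_left_ray; rewrite sub0r => -[-> wx].
have [|y [Xy yx ys]] := ws x 0 Xx; first by rewrite sub0r.
exists y => //; apply/esym.
rewrite ray_cat_rcons.
apply/ray_rcons_left_ray; split; last by rewrite -ys add0r.
apply/ray_cat_left_ray; split.
  by apply/eq_left_ray => j lej; rewrite -yx; [congr (y _)|]; lia.
rewrite {1}wx; apply/eq_block => j ltj.
by rewrite -yx; [congr (y _)|]; lia.
Qed.

End Words.

(** * From an RI-mapping to a presentation with property g *)

Section RIToG.
Variables (S : finType) (X : set (full_shift S)) (L : nat).
Variable Psi : seq S -> seq S.
Hypotheses (sX : subshift X) (riPsi : RI_mapping X L Psi).
Implicit Types x y : full_shift S.

Definition Psi_at x (i : int) : seq S := Psi (block x (i - L%:Z) (2 * L).+1).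

Lemma Psi_at_translate x k i : Psi_at (translate k x) i = Psi_at x (i + k).
Proof.
by congr Psi; apply/eq_block => j _; rewrite /translate; congr (x _); lia.
Qed.

Lemma size_Psi_at x i : X x -> size (Psi_at x i) = L.+1.
Proof.
case: riPsi => domPsi _ _ Xx; rewrite /Psi_at.
have [|y _ <-] := domPsi (block x (i - L%:Z) (2 * L).+1).
  exists (translate i x); first exact: subshift_translate.
  by apply/eq_block => j _; rewrite /translate; congr (x _); lia.
by rewrite size_block.
Qed.

(** (RIa) supplies [y]. The last clause rests on (RIb): the letters of the presentation at all
    [i <= 0] survive, although their windows may reach into the replaced part. *)
Lemma RI_extension0 x : X x -> exists y,
  [/\ X y, forall j : int, j <= 0 -> y j = x j, block y 1 L.+1 = Psi_at x 0 &
      forall i : int, i <= 0 -> Psi_at y i = Psi_at x i].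
Proof.
move=> Xx; case: riPsi => _ PsiA PsiB.
have [|||y Xy] := PsiA (block x (- L%:Z) (2 * L).+1) (left_ray x (- L%:Z - 1)).
- by exists x.
- by exists x.
- exists x => //; apply/esym/ray_cat_left_ray; rewrite size_block.
  by split; [congr left_ray|congr block]; lia.
have PE : Psi (block x (- L%:Z) (2 * L).+1) = Psi_at x 0.
  by rewrite /Psi_at sub0r.
rewrite take_block; last by lia.
rewrite PE => /esym/ray_cat_left_ray.
rewrite size_cat size_block size_Psi_at//.
have -> : L.+1%:Z - (L.+1 + L.+1)%:Z = - L%:Z - 1 by lia.
rewrite subrK block_cat => -[/eq_left_ray yx_far].
move=> /eqP; rewrite eqseq_cat ?size_block// => /andP[/eqP yx_near /eqP yPsi].
have yx (j : int) : j <= 0 -> y j = x j.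
  move=> j0; have [jL|jL] : j <= - L%:Z - 1 \/ - L%:Z <= j by lia.
    have := yx_far (j + L%:Z + 1).
    have -> : - L%:Z - 1 + (j + L%:Z + 1) = j by lia.
    by move=> ->//; lia.
  move/eq_block : yx_near => /(_ (absz (j + L%:Z))).
  have -> : - L%:Z + (absz (j + L%:Z))%:Z = j by lia.
  by move=> ->//; lia.
have {}yPsi : block y 1 L.+1 = Psi_at x 0.
  by rewrite yPsi; congr block; lia.
exists y; split=> // i i0.
have [n iE] : exists n : nat, i = - n%:Z by exists `|i|%N; lia.
(* For [n >= L] the window [[-n - L, -n + L]] lies in the unchanged half-line. *)
have [ltnL|leLn] := ltnP n L; last first.
  by congr Psi; apply/eq_block => j ltj; apply: yx; lia.
(* For [b] the block of [x] on [[-L - n, L]], the word a_{n,b} of (RIb) is the block of [y] on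
   [[-L - n, L - n]]. *)
have := PsiB n (block x (- (L + n)%:Z) (2 * L + n).+1) ltnL.
rewrite /RI_word take_block ?drop_block ?take_block; try lia.
have -> : - (L + n)%:Z + n%:Z = - L%:Z by lia.
have -> : ((2 * L + n).+1 - n)%N = (2 * L).+1 by lia.
rewrite PE -yPsi take_block; last by lia.
have -> : block x (- (L + n)%:Z) (L + n).+1 ++ block y 1 (L - n) =
    block y (- (L + n)%:Z) (2 * L).+1.
  have -> : (2 * L).+1 = ((L + n).+1 + (L - n))%N by lia.
  rewrite block_cat; congr (_ ++ _); last by congr block; lia.
  by apply/eq_block => j ltj; rewrite yx//; lia.
rewrite /Psi_at; have -> : i - L%:Z = - (L + n)%:Z by lia.
by apply; exists x.
Qed.

Lemma RI_extension x (m : int) : X x -> exists y,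
  [/\ X y, forall j : int, j <= m -> y j = x j,
      block y (m + 1) L.+1 = Psi_at x m &
      forall i : int, i <= m -> Psi_at y i = Psi_at x i].
Proof.
move=> Xx; have [//|y [Xy yx yPsi yxPsi]] := @RI_extension0 (translate m x).
  exact: subshift_translate.
exists (translate (- m) y); split; first exact: subshift_translate.
- move=> j lejm; rewrite /translate yx; last by lia.
  by rewrite /translate; congr (x _); lia.
- rewrite -[m in RHS]add0r -Psi_at_translate -yPsi; apply/eq_block => j _.
  by rewrite /translate; congr (y _); lia.
- move=> i leim; rewrite Psi_at_translate yxPsi; last by lia.
  by rewrite Psi_at_translate; congr Psi_at; lia.
Qed.

(* The option only serves to make the alphabet finite: on X, [insub] is [Some]
   since Psi_at has length L + 1. *)
Definition RI_letter : finType := (S * option (L.+1.-tuple S))%type.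

Definition RI_code x : full_shift RI_letter := fun i => (x i, insub (Psi_at x i)).

Definition RI_presentation : set (full_shift RI_letter) := [set RI_code x | x in X].

Lemma eq_RI_code x y i k : X x -> X y ->
  RI_code x i = RI_code y k <-> x i = y k /\ Psi_at x i = Psi_at y k.
Proof.
move=> Xx Xy; rewrite /RI_code; split=> [[->]|[-> ->]//].
by do 2![rewrite insubT ?size_Psi_at// => ?] => -[->].
Qed.

Lemma RI_code_shift x : RI_code (shift x) = shift (RI_code x).
Proof.
apply/funext => i; congr (_, insub _); exact: (Psi_at_translate x 1).
Qed.

Lemma RI_code_local x y i k :
  (forall j : int, (`|j| <= L)%N -> x (i + j) = y (k + j)) ->
  RI_code x i = RI_code y k.
Proof.
move=> xy; congr (_, insub (Psi _)); first by have := xy 0; rewrite !addr0; exact.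
apply/eq_block => j ltj; have := xy (j%:Z - L%:Z).
by rewrite !addrA ![_ + j%:Z - L%:Z]addrAC; apply; lia.
Qed.

Lemma RI_code_continuous : continuous RI_code.
Proof.
move=> x U /nbhs_cylinderP [n cU]; apply/nbhs_cylinderP; exists (n + L)%N => y cy.
apply: cU => i lei; apply: RI_code_local => j lej; apply: cy; lia.
Qed.

(** Closedness holds because a continuous image of a compact set is compact, hence closed in a
    Hausdorff space. *)
Lemma RI_presentation_subshift : subshift RI_presentation.
Proof.
split.
  apply: compact_closed; first exact: full_shift_hausdorff.
  apply: continuous_compact; last exact: subshift_compact.
  exact/continuous_subspaceT/RI_code_continuous.
case: sX => _ shX; apply/seteqP; split=> [_ [_ [x Xx <-] <-]|_ [x Xx <-]].
  by exists (shift x); [rewrite -shX; exists x|exact: RI_code_shift].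
move: Xx; rewrite -{1}shX => -[y Xy <-]; exists (RI_code y); first by exists y.
by rewrite RI_code_shift.
Qed.

(** The inverse code is the projection to first components, a code of radius 0. *)
Lemma RI_presentation_conjugate : conjugate X RI_presentation.
Proof.
have codeP (u : X) : RI_code (val u) \in RI_presentation.
  by apply/mem_set; exists (val u) => //; exact: set_valP.
have decodeP (v : RI_presentation) : (fun i => (val v i).1) \in X.
  by apply/mem_set; have [x Xx <-] := set_valP v.
pose f (u : X) : RI_presentation := SigSub (codeP u).
pose g (v : RI_presentation) : X := SigSub (decodeP v).
exists f, g; split.
- apply: (@local_continuous _ _ _ _ f L) => u v k uv.
  exact: RI_code_local.
- apply: (@local_continuous _ _ _ _ g 0) => u v k /(_ 0 (leqnn _)).
  by rewrite addr0 => /= ->.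
- by move=> u; apply/val_inj.
- move=> v; apply/val_inj => /=; have [x Xx xv] := set_valP v.
  by rewrite -xv.
- by move=> u v /= ->; exact: RI_code_shift.
Qed.

Lemma RI_presentation_g : property_g RI_presentation.
Proof.
(* The witness is the letter at coordinate 1 of the extended point; [n = L] gives the context of
   [L + 1] letters on [[-L, 0]]. *)
move=> _ [_ [x Xx <-] <-]; have [y [Xy yx yPsi _]] := RI_extension 0 Xx.
exists (RI_code y 1); exists L => //.
rewrite ray_suffix_left_ray; apply/omega1P; first exact: RI_presentation_subshift.
rewrite size_block => _ m [z Xz <-] zx.
have zxL (j : int) : - L%:Z <= j <= 0 -> z (m + j) = x j /\ Psi_at z (m + j) = Psi_at x j.
  move=> jL; apply/eq_RI_code => //.
  have /eq_block /(_ (absz (j + L%:Z))) := zx.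
  have -> : m - L.+1%:Z + 1 + (absz (j + L%:Z))%:Z = m + j by lia.
  have -> : 0 - L.+1%:Z + 1 + (absz (j + L%:Z))%:Z = j by lia.
  by apply; lia.
(* The arbitrary point [z] shows the context at [m]; its own extension leaves its code unchanged up
   to [m]. *)
have [t [Xt tz tPsi tzPsi]] := RI_extension m Xz.
exists (RI_code t); split; first by exists t.
  by move=> j lej; apply/eq_RI_code => //; split; [exact: tz|exact: tzPsi].
have {}tPsi : block t (m + 1) L.+1 = block y 1 L.+1.
  by rewrite tPsi yPsi; have [] := zxL 0; [lia|rewrite addr0].
(* The letter at [m + 1] reads [t] on [[m + 1 - L, m + 1 + L]]. Up to [m] these symbols are first
   components of the context; beyond [m] they form the word stored in its last letter. *)
apply: RI_code_local => j lej; have [j0|j0] : j < 0 \/ 0 <= j by lia.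
  rewrite tz ?yx; [|lia..]; have [+ _] := zxL (1 + j) ltac:(lia).
  by rewrite addrA.
have /eq_block /(_ `|j|%N) := tPsi.
have -> : `|j|%N%:Z = j by lia.
by apply; lia.
Qed.

End RIToG.

(** * Sliding block codes and uniform memory *)

Section SlidingBlockCode.
Variables (S T : finType) (X : set (full_shift S)) (Y : set (full_shift T)).
Variable f : X -> Y.
Hypotheses (sX : subshift X) (cf : continuous f).
Hypothesis f_shift :
  forall u v : X, val v = shift (val u) -> val (f v) = shift (val (f u)).

Lemma commute_translate (u v : X) (k : int) :
  val v = translate k (val u) -> val (f v) = translate k (val (f u)).
Proof.
have comN (n : nat) (u1 v1 : X) : val v1 = translate n%:Z (val u1) ->
    val (f v1) = translate n%:Z (val (f u1)).
  elim: n v1 => [|n IHn] v1 v1u1.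
    have -> : v1 = u1.
      by apply/val_inj; rewrite v1u1 /shift; apply/funext => i; rewrite /translate; congr (val u1 _); lia.
    by apply/funext => i; rewrite /translate; congr (val (f u1) _); lia.
  have wP : translate n%:Z (val u1) \in X.
    exact: mem_set (subshift_translate n%:Z sX (set_valP u1)).
  rewrite (@f_shift (SigSub wP)) ?(IHn (SigSub wP))//.
    by apply/funext => i; rewrite /shift /translate; congr (val (f u1) _); lia.
  by rewrite v1u1 /shift; apply/funext => i; rewrite /translate; congr (val u1 _); lia.
have [n [->|->]] : exists n : nat, k = n%:Z \/ k = - n%:Z by exists `|k|%N; lia.
  exact: comN.
(* For a negative power the roles are swapped: [u] is the translate of [v] by [n]. *)
move=> vu; rewrite (comN n v u).
  by apply/funext => i; rewrite /translate; congr (val (f v) _); lia.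
by rewrite vu; apply/funext => i; rewrite /translate; congr (val u _); lia.
Qed.

(** Curtis-Hedlund-Lyndon: continuity gives a window around each point, compactness a common one at
    coordinate 0, and commutation with translations carries it to all coordinates. *)
Lemma sliding_block_code : exists M : nat, forall (u v : X) (k l : int),
  (forall j : int, (`|j| <= M)%N -> val u (k + j) = val v (l + j)) ->
  val (f u) k = val (f v) l.
Proof.
pose P n (x : full_shift S) := forall u v : X,
  val u = x -> cylinder n x (val v) -> val (f v) 0 = val (f u) 0.
have [||M PM] := @compact_uniform S X P (subshift_compact sX).
- move=> m n x lemn _ Pm u v ux xv; apply: Pm => // j lej.
  by apply: xv; exact: leq_trans lej lemn.
- move=> x Xx; pose u0 : X := SigSub (mem_set Xx).
  have [m fm] := continuous_cylinder 0 u0 cf; exists m => y Xy xy u v uy yv.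
  rewrite (fm u)//; last by rewrite uy.
  by rewrite (fm v)// => j lej; rewrite yv// xy.
exists M => u v k l uv.
have trP (w : X) (i : int) : translate i (val w) \in X.
  exact: mem_set (subshift_translate i sX (set_valP w)).
have fE (w : X) i : val (f w) i = val (f (SigSub (trP w i))) 0.
  by rewrite (@commute_translate w (SigSub (trP w i)) i)// /translate; congr (val (f w) _); lia.
rewrite fE [RHS]fE; symmetry; apply: PM => //; first exact/set_mem/trP.
by move=> j lej; rewrite /= /translate addrC -uv// addrC.
Qed.

End SlidingBlockCode.

(** A longer context admits fewer pasts. This is the monotonicity that the compactness argument
    requires. *)
Lemma omega1_suffix (S : finType) (X : set (full_shift S)) (w w' : seq S) s :
  subshift X -> omega1 X w s -> omega1 X (w' ++ w) s.
Proof.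
move=> sX /(omega1P _ _ sX) ws; apply/omega1P => // x m Xx.
rewrite size_cat block_cat => /eqP; rewrite eqseq_cat ?size_block//.
move=> /andP[_ /eqP xw]; apply: ws => //; rewrite -{3}xw; congr block; lia.
Qed.

(** The memory that suffices at [x] depends on a finite block of [x], so it also suffices on a
    cylinder around [x], and [compact_uniform] applies at coordinate 0; translation frees the
    position. *)
Lemma property_g_uniform (S : finType) (X : set (full_shift S)) :
  subshift X -> property_g X -> exists N : nat, forall x (i : int), X x ->
    omega1 X (block x i N.+1) !=set0.
Proof.
move=> sX gX.
pose P n x := omega1 X (block x (- n%:Z) n.+1) !=set0.
have [||N PN] := @compact_uniform S X P (subshift_compact sX).
- move=> m n x lemn _ [s xs]; exists s.
  have -> : n.+1 = ((n - m) + m.+1)%N by lia.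
  rewrite block_cat; have -> : - n%:Z + (n - m)%N%:Z = - m%:Z by lia.
  exact: omega1_suffix.
- move=> x Xx; have [|s [n _]] := gX (left_ray x 0); first by exists x.
  rewrite ray_suffix_left_ray; have -> : 0 - n.+1%:Z + 1 = - n%:Z by lia.
  move=> xs; exists n => y _ xy; exists s.
  rewrite (_ : block y _ _ = block x (- n%:Z) n.+1)//.
  by apply/eq_block => j ltj; apply: xy; lia.
exists N => x i Xx; have := PN (translate (i + N%:Z) x).
rewrite /P; have -> : block (translate (i + N%:Z) x) (- N%:Z) N.+1 = block x i N.+1.
  by apply/eq_block => j _; congr (x _); lia.
by apply; exact: subshift_translate.
Qed.

(** * Deterministic continuation of pasts under property g *)

Section CanonicalContinuation.
Variables (T : finType) (Y : set (full_shift T)) (N : nat).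
Hypothesis sY : subshift Y.
Hypothesis omegaN :
  forall y (i : int), Y y -> omega1 Y (block y i N.+1) !=set0.

(** [pick] makes a fixed choice, so the symbol is a function of the word alone. By [omegaN], [None]
    does not arise on blocks of length [N + 1] of points of [Y]. *)
Definition next_symbol (w : seq T) : option T := [pick s | `[< omega1 Y w s >]].

(* [y] continues [y_(-oo, m]] by [n] applications of [next_symbol]. *)
Definition canonical (y : full_shift T) (m : int) (n : nat) :=
  forall i : nat, (i < n)%N ->
    Some (y (m + i.+1%:Z)) = next_symbol (block y (m + i%:Z - N%:Z) N.+1).

(** A symbol of [omega1] may follow every past with the given context, so each step appends one
    symbol and changes nothing to its left, in particular no earlier context. *)
Lemma canonical_exists y (m : int) (n : nat) : Y y -> exists z,
  [/\ Y z, forall j : int, j <= m -> z j = y j & canonical z m n].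
Proof.
move=> Yy; elim: n => [|n [z [Yz zy zcan]]]; first by exists y.
pose w := block z (m + n%:Z - N%:Z) N.+1.
have [s nexts] : exists s, next_symbol w = Some s /\ omega1 Y w s.
  rewrite /next_symbol; case: pickP => [s /asboolP ws|now]; first by exists s.
  by have [s ws] := omegaN (m + n%:Z - N%:Z) Yz; have := now s; rewrite asboolT.
have [wE /(omega1P _ _ sY) ws] := nexts.
have [||t [Yt tz ts]] := ws z (m + n%:Z) => //.
  by rewrite size_block; congr block; lia.
exists t; split=> // [j lej|i]; first by rewrite tz ?zy//; lia.
rewrite ltnS => lein.
have -> : block t (m + i%:Z - N%:Z) N.+1 = block z (m + i%:Z - N%:Z) N.+1.
  by apply/eq_block => j ltj; apply: tz; lia.
have [ltin|] := ltnP i n; first by rewrite tz ?zcan//; lia.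
rewrite leq_eqVlt ltnNge lein orbF => /eqP <-.
by rewrite wE -ts; congr (Some (t _)); lia.
Qed.

(** Each new symbol is a function of the preceding [N + 1] symbols, so equal contexts on [[-N, 0]]
    propagate to the right. *)
Lemma canonical_unique y z (m k : int) (n : nat) :
  canonical y m n -> canonical z k n ->
  (forall j : int, - N%:Z <= j <= 0 -> y (m + j) = z (k + j)) ->
  forall j : int, - N%:Z <= j <= n%:Z -> y (m + j) = z (k + j).
Proof.
move=> ycan zcan yz; elim: n ycan zcan => [|n IHn] ycan zcan //.
have {}IHn : forall j : int, - N%:Z <= j <= n%:Z -> y (m + j) = z (k + j).
  by apply: IHn => i ltin; [apply: ycan|apply: zcan]; exact: ltnW.
move=> j lej; have [|->] : - N%:Z <= j <= n%:Z \/ j = n.+1%:Z by lia.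
  exact: IHn.
apply: Some_inj; rewrite ycan// zcan//; congr next_symbol.
apply/eq_block => i ltiN; rewrite -!addrA; apply: IHn; lia.
Qed.

End CanonicalContinuation.

(** * From a conjugate subshift with property g to an RI-mapping *)

Section GToRI.
Variables (S T : finType) (X : set (full_shift S)) (Y : set (full_shift T)).
Variables (f : X -> Y) (g : Y -> X) (M N : nat).
Hypothesis sY : subshift Y.
Hypotheses (fK : cancel f g) (gK : cancel g f).
Hypothesis f_local : forall (u v : X) (k l : int),
  (forall j : int, (`|j| <= M)%N -> val u (k + j) = val v (l + j)) ->
  val (f u) k = val (f v) l.
Hypothesis g_local : forall (u v : Y) (k l : int),
  (forall j : int, (`|j| <= M)%N -> val u (k + j) = val v (l + j)) ->
  val (g u) k = val (g v) l.
Hypothesis omegaN :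
  forall y (i : int), Y y -> omega1 Y (block y i N.+1) !=set0.

(** Coding [[k - L, k + L]] with radius [M] determines the image on [[k + M - L, k + M]]. This
    contains the context [[k + M - N, k + M]] and, as [L >= 2M], all that decoding from [k + 1] on
    reads up to [k + M]. *)
Let L := (N + 2 * M)%N.

(** The image is kept up to [k + M], so that decoding with radius [M] restores [u] up to [k]. The
    [L + 1] new symbols end at [k + M + L + 1], the last coordinate read in decoding
    [[k + 1, k + L + 1]]. *)
Definition g_extension (u : X) (v : Y) (k : int) :=
  (forall j : int, j <= k + M%:Z -> val v j = val (f u) j) /\
  canonical Y N (val v) (k + M%:Z) L.+1.

(** A relation comes first because many points [u] carry the same word [a]; independence of the
    choice is [RI_graph_functional]. *)
Definition RI_graph (a w : seq S) := exists (u : X) (v : Y) (k : int),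
  [/\ a = block (val u) (k - L%:Z) (2 * L).+1, g_extension u v k &
      w = block (val (g v)) (k + 1) L.+1].

Lemma g_extension_exists (u : X) (k : int) : exists v, g_extension u v k.
Proof.
have [y [Yy yu ycan]] :=
  canonical_exists sY omegaN (k + M%:Z) L.+1 (set_valP (f u)).
by exists (SigSub (mem_set Yy)).
Qed.

Lemma g_extension_left (u : X) (v : Y) (k j : int) :
  g_extension u v k -> j <= k -> val (g v) j = val u j.
Proof.
move=> [vu _] lejk; rewrite -[in RHS](fK u).
by apply: g_local => i lei; apply: vu; lia.
Qed.

Lemma RI_graph_functional a w1 w2 : RI_graph a w1 -> RI_graph a w2 -> w1 = w2.
Proof.
move=> [u1 [v1 [k1 [-> [vu1 can1] ->]]]] [u2 [v2 [k2 [a12 [vu2 can2] ->]]]].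
have u12 (j : int) : - L%:Z <= j <= L%:Z -> val u1 (k1 + j) = val u2 (k2 + j).
  move=> jL; have /eq_block/(_ (absz (j + L%:Z))) := a12.
  have -> : k1 - L%:Z + (absz (j + L%:Z))%:Z = k1 + j by lia.
  have -> : k2 - L%:Z + (absz (j + L%:Z))%:Z = k2 + j by lia.
  by apply; lia.
have v12 (j : int) : - L%:Z <= j <= 0 ->
    val v1 (k1 + M%:Z + j) = val v2 (k2 + M%:Z + j).
  move=> jL; rewrite vu1 ?vu2; [|lia..].
  by apply: f_local => i lei; rewrite -!addrA; apply: u12; lia.
have v12can := canonical_unique can1 can2 (fun j jN => v12 j ltac:(lia)).
apply/eq_block => i ltiL; apply: g_local => j lej.
have kE (k : int) : k + 1 + i%:Z + j = k + M%:Z + (1 + i%:Z + j - M%:Z) by lia.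
rewrite (kE k1) (kE k2).
(* Offsets are taken from [k + M]: nonpositive ones are settled by coding equal blocks, the others
   by uniqueness of the canonical continuation. *)
have [j0|j0] : 1 + i%:Z + j - M%:Z <= 0 \/ 0 <= 1 + i%:Z + j - M%:Z by lia.
  by apply: v12; lia.
by apply: v12can; lia.
Qed.

(** The default [[::]] is taken only outside the blocks of length [2L + 1] of [X], since
    [g_extension_exists] puts each such block in the domain of the graph. *)
Definition RI_map (a : seq S) : seq S := xget [::] (RI_graph a).

Lemma RI_mapE a w : RI_graph a w -> RI_map a = w.
Proof.
by move=> aw; exact: (RI_graph_functional (xgetPex [::] (ex_intro _ w aw)) aw).
Qed.

Lemma RI_map_block (u : X) (v : Y) (k : int) : g_extension u v k ->
  RI_map (block (val u) (k - L%:Z) (2 * L).+1) = block (val (g v)) (k + 1) L.+1.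
Proof. by move=> uv; apply: RI_mapE; exists u, v, k. Qed.

Lemma RI_map_mapping : RI_mapping X L RI_map.
Proof.
split.
- move=> _ [x Xx <-]; pose u : X := SigSub (mem_set Xx).
  have [v uv] := g_extension_exists u 0.
  rewrite -[- L%:Z]sub0r (RI_map_block uv) add0r.
  by exists (val (g v)) => //; exact: set_valP.
(* The point [x] carries both the past [r] and [a]. The map depends on [a] alone, so its value may
   be computed from an extension of this [x]. *)
- move=> a r [y _ ya] _ [x Xx]; pose u : X := SigSub (mem_set Xx).
  have [v uv] := g_extension_exists u 0.
  have size_a : size a = (2 * L).+1 by rewrite -ya size_block.
  move=> /esym/ray_cat_left_ray; rewrite size_a => -[-> ->] {a ya size_a}.
  have -> : L%:Z - (2 * L).+1%:Z + 1 = 0 - L%:Z by lia.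
  rewrite (RI_map_block uv); exists (val (g v)); first exact: set_valP.
  apply/esym/ray_cat_left_ray; rewrite size_cat take_block; last by lia.
  rewrite !size_block block_cat; split.
    by apply/eq_left_ray => j lej; rewrite (g_extension_left uv); [congr (x _)|]; lia.
  congr (_ ++ _); last by congr block; lia.
  by apply/eq_block => j lej; rewrite (g_extension_left uv); [congr (x _)|]; lia.
- move=> n b ltnL [x Xx <-]; pose u : X := SigSub (mem_set Xx).
  have [v uv] := g_extension_exists u 0.
  rewrite /RI_word !take_block ?drop_block; try lia.
  have -> : - (L + n)%:Z + n%:Z = 0 - L%:Z by lia.
  have -> : ((2 * L + n).+1 - n)%N = (2 * L).+1 by lia.
  rewrite (RI_map_block uv) take_block; last by lia.
  have -> : block x (- (L + n)%:Z) (L + n).+1 ++ block (val (g v)) (0 + 1) (L - n)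
      = block (val (g v)) (- n%:Z - L%:Z) (2 * L).+1.
    have -> : (2 * L).+1 = ((L + n).+1 + (L - n))%N by lia.
    rewrite block_cat; congr (_ ++ _); last by congr block; lia.
    by apply/eq_block => j lej; rewrite (g_extension_left uv); [congr (x _)|]; lia.
  have -> : - (L + n)%:Z = - n%:Z - L%:Z by lia.
  (* Since [f (g v) = v] agrees with [f u] up to [M], the extension [w] of [g v] at [-n] is also an
     extension of [u] at [-n]; both sides of (RIb) are thus read off [w]. *)
  have [w [wv wcan]] := g_extension_exists (g v) (- n%:Z).
  rewrite (@RI_map_block (g v) w)//; apply/esym/(@RI_map_block u w); split=> // j lej.
  by rewrite wv// gK; case: uv => -> //; lia.
Qed.

End GToRI.

Theorem proposition4p2 (S : finType) (X : set (full_shift S))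
    (hX : subshift X) :
  (exists (T : finType) (Y : set (full_shift T)),
     [/\ subshift Y, conjugate X Y & property_g Y])
  <-> property_RI X.
Proof.
split=> [[T [Y [sY [f [g [cf cg fK gK f_shift]]] gY]]]|[L [Psi riPsi]]]; last first.
  exists (RI_letter S L), (@RI_presentation S X L Psi); split.
  - exact: RI_presentation_subshift.
  - exact: RI_presentation_conjugate.
  - exact: RI_presentation_g.
(* [conjugate] states commutation with the shift for [f]; the inverse inherits it by applying
   [f_shift] to the shift of [g u]. *)
have g_shift (u v : Y) : val v = shift (val u) -> val (g v) = shift (val (g u)).
  move=> vu; have wP : shift (val (g u)) \in X.
    exact: mem_set (subshift_translate 1 hX (set_valP (g u))).
  pose w : X := SigSub wP; suff -> : v = f w by rewrite fK.
  by apply/val_inj; rewrite vu (f_shift (g u))// gK.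
have [Mf f_local] := sliding_block_code hX cf f_shift.
have [Mg g_local] := sliding_block_code sY cg g_shift.
have [N omegaN] := property_g_uniform sY gY.
(* The larger of the two radii serves as a common window for both codes. *)
exists (N + 2 * maxn Mf Mg)%N, (RI_map f g (maxn Mf Mg) N).
apply: RI_map_mapping => // u v k l uv; [apply: f_local|apply: g_local];
  by move=> j lej; apply: uv; rewrite leq_max lej ?orbT.
Qed.
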